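(* Let $N \ge 1$ be an integer and let $G$ be a multiplicative subgroup of units in a unital commutative ring $R$. Given $A \in R^{N \times N}$, there exists a unique minimal partition $\pi = \{I_1, \ldots, I_m\}$ of $\{1,\ldots,N\}$ such that, for all $i, j \in \{1,\ldots,m\}$, the entries of the block submatrix $A_{I_i \times I_j}$ lie in a single $G$-orbit.
   Context: $\Pi_N$ denotes the set of all partitions of $\{1,\ldots,N\}$, partially ordered by $\pi' \prec \pi$ if and only if $\pi$ is a refinement of $\pi'$ (so minimal means coarsest). $A_{I_i \times I_j}$ is the submatrix of $A$ with rows indexed by $I_i$ and columns indexed by $I_j$. $G$ acts on $R$ by multiplication; the $G$-orbit of $a \in R$ is $Ga = \{ga : g \in G\}$. *)

(* Defs.v *)
From mathcomp Require Import all_boot all_algebra.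

Set Implicit Arguments.
Unset Strict Implicit.
Unset Printing Implicit Defensive.

Import GRing.Theory.
Local Open Scope ring_scope.

(* Stated over [comPzRingType] (so that the zero ring is allowed), where
   [GRing.unit] is not available: the last clause says that every element of
   [G] is a unit of [R] and that its inverse is again in [G]. *)
Definition unit_subgroup (R : comPzRingType) (G : R -> Prop) : Prop :=
  [/\ G 1,
      forall g h, G g -> G h -> G (g * h)
    & forall g, G g -> exists2 h, G h & g * h = 1].

Definition unit_orbit (R : comPzRingType) (G : R -> Prop) (a b : R) : Prop :=
  exists2 g, G g & b = g * a.

Definition block_submx (R : Type) (N : nat) (A : 'M[R]_N) (I J : {set 'I_N}) :
    'M[R]_(#|I|, #|J|) :=
  mxsub (fun k : 'I_#|I| => enum_val k) (fun l : 'I_#|J| => enum_val l) A.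

Definition single_orbit_mx (R : comPzRingType) (G : R -> Prop) (m n : nat)
    (B : 'M[R]_(m, n)) : Prop :=
  exists a : R, forall k l, unit_orbit G a (B k l).

(* [coarser pi' pi] is the order pi' \prec pi: pi is a refinement of pi'. *)
Definition coarser (T : finType) (pi' pi : {set {set T}}) : Prop :=
  forall I, I \in pi -> exists2 I', I' \in pi' & I \subset I'.

Definition block_orbit_partition (R : comPzRingType) (G : R -> Prop) (N : nat)
    (A : 'M[R]_N) (pi : {set {set 'I_N}}) : Prop :=
  partition pi [set: 'I_N] /\
  forall I J, I \in pi -> J \in pi -> single_orbit_mx G (block_submx A I J).

Definition minimal_partition (T : finType) (P : {set {set T}} -> Prop)
    (pi : {set {set T}}) : Prop :=
  P pi /\ forall pi', P pi' -> coarser pi' pi -> pi' = pi.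

(* Main.v *)
Require Import Defs.
From mathcomp Require Import all_boot all_algebra.
From mathcomp Require Import boolp.

(** The partition can be written down. Call two indices [i] and [i'] twins
    when rows [i] and [i'] of [A] agree up to orbits, entry by entry, and so do
    columns [i] and [i']. This is an equivalence relation because lying in a
    common [G]-orbit is one. If [i], [i'] are twins and [j], [j'] are twins then
    [A i j], [A i' j], [A i' j'] lie in one orbit (change the row, then the
    column), so the twin classes form an admissible partition
    ([twin_partition_admissible]). Conversely, two indices in the same block of
    an admissible partition are twins: a test index [j] lies in some block [J],
    and the entries [A i j] and [A i' j] both belong to the block [I x J]. Hence
    every admissible partition refines the twin partition
    ([twin_partition_coarsest]). The twin partition is therefore the least
    admissible one, and in a partial order a least element is the unique
    minimal element ([coarser_antisym] supplies antisymmetry).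

    Membership in [G] is an arbitrary proposition, so being twins is undecidable
    in general; excluded middle turns it into a boolean relation that has a
    quotient partition. *)

Set Implicit Arguments.
Unset Strict Implicit.
Unset Printing Implicit Defensive.

Import GRing.Theory.
Local Open Scope ring_scope.

Section Orbits.

Variables (R : comPzRingType) (G : R -> Prop).
Hypothesis hG : unit_subgroup G.

Lemma unit_orbit_refl a : unit_orbit G a a.
Proof. by case: hG => G1 _ _; exists 1; rewrite ?mul1r. Qed.

Lemma unit_orbit_sym a b : unit_orbit G a b -> unit_orbit G b a.
Proof.
case: hG => _ _ GV [g Gg ->]; have [h Gh gh1] := GV g Gg.
by exists h => //; rewrite mulrA (mulrC h) gh1 mul1r.
Qed.

Lemma unit_orbit_trans a b c :
  unit_orbit G a b -> unit_orbit G b c -> unit_orbit G a c.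
Proof.
case: hG => _ GM _ [g Gg ->] [h Gh ->].
by exists (h * g); rewrite ?mulrA //; apply: GM.
Qed.

(** Replaces the representative of the orbit, and the positions inside the
    block, by a comparison of entries of [A] itself. Nonemptiness provides an
    entry to serve as representative. *)
Lemma single_orbit_blockP (N : nat) (A : 'M[R]_N) (I J : {set 'I_N}) :
    I != set0 -> J != set0 ->
  single_orbit_mx G (block_submx A I J) <->
  (forall i i' j j', i \in I -> i' \in I -> j \in J -> j' \in J ->
     unit_orbit G (A i j) (A i' j')).
Proof.
move=> /set0Pn[i0 Ii0] /set0Pn[j0 Jj0]; split.
  move=> [a Ha] i i' j j' Ii Ii' Jj Jj'.
  have Ha' k l : k \in I -> l \in J -> unit_orbit G a (A k l).
    move=> Ik Jl; have := Ha (enum_rank_in Ik k) (enum_rank_in Jl l).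
    by rewrite mxE !enum_rankK_in.
  exact: unit_orbit_trans (unit_orbit_sym (Ha' _ _ Ii Jj)) (Ha' _ _ Ii' Jj').
by move=> H; exists (A i0 j0) => k l; rewrite mxE; apply: H => //; apply: enum_valP.
Qed.

End Orbits.

Section Coarser.

Variable T : finType.

Lemma partition_block_neq0 (D : {set T}) (pi : {set {set T}}) (I : {set T}) :
  partition pi D -> I \in pi -> I != set0.
Proof. by case/and3P=> _ _ pi0 piI; apply: contraNneq pi0 => <-. Qed.

(** A block of [pi] sits in a block of [pi'], which sits in a block of [pi];
    the outer two meet, hence coincide, and the middle one is squeezed. *)
Lemma coarser_subset (D : {set T}) (pi pi' : {set {set T}}) :
  partition pi D -> coarser pi pi' -> coarser pi' pi -> pi \subset pi'.
Proof.
move=> p c c'; have [_ tI _] := and3P p; apply/subsetP=> I piI.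
have [I' piI' sII'] := c' I piI; have [J piJ sI'J] := c I' piI'.
have /set0Pn[x Ix] := partition_block_neq0 p piI.
have eIJ : I = J.
  have Jx : x \in J by apply: (subsetP sI'J); apply: (subsetP sII').
  by rewrite -(def_pblock tI piI Ix) (def_pblock tI piJ Jx).
suff -> : I = I' by [].
by apply/eqP; rewrite eqEsubset sII' eIJ.
Qed.

Lemma coarser_antisym (D : {set T}) (pi pi' : {set {set T}}) :
    partition pi D -> partition pi' D ->
  coarser pi pi' -> coarser pi' pi -> pi = pi'.
Proof.
move=> p p' c c'; apply/eqP; rewrite eqEsubset.
by rewrite (coarser_subset p) // (coarser_subset p').
Qed.

End Coarser.

Section Twins.

Variables (R : comPzRingType) (G : R -> Prop) (N : nat) (A : 'M[R]_N).
Hypothesis hG : unit_subgroup G.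

Definition twins (i i' : 'I_N) : Prop :=
  forall j, unit_orbit G (A i j) (A i' j) /\ unit_orbit G (A j i) (A j i').

Definition twin_partition : {set {set 'I_N}} :=
  equivalence_partition (fun i i' => `[< twins i i' >]) [set: 'I_N].

Lemma twins_equivalence :
  {in [set: 'I_N] & &, equivalence_rel (fun i i' => `[< twins i i' >])}.
Proof.
have sym i j : twins i j -> twins j i.
  by move=> t k; case: (t k) => ? ?; split; apply: unit_orbit_sym.
have trans i j k : twins i j -> twins j k -> twins i k.
  move=> t u l; case: (t l) (u l) => t1 t2 [u1 u2].
  by split; [apply: unit_orbit_trans t1 u1 | apply: unit_orbit_trans t2 u2].
move=> i j k _ _ _; split.
  by apply/asboolP => l; split; apply: unit_orbit_refl.
move=> /asboolP tij; apply/asboolP/asboolP; last exact: trans.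
by apply: trans; apply: sym.
Qed.

Lemma twin_partitionP : partition twin_partition [set: 'I_N].
Proof. exact: equivalence_partitionP twins_equivalence. Qed.

Lemma mem_pblock_twin i i' : i' \in pblock twin_partition i <-> twins i i'.
Proof.
rewrite pblock_equivalence_partition ?inE //; last exact: twins_equivalence.
by split=> /asboolP.
Qed.

Lemma twins_block I i i' :
  I \in twin_partition -> i \in I -> i' \in I -> twins i i'.
Proof.
case/and3P: twin_partitionP => _ tI _ piI Ii Ii'.
by apply/mem_pblock_twin; rewrite (def_pblock tI piI Ii).
Qed.

Lemma twin_partition_admissible : block_orbit_partition G A twin_partition.
Proof.
have p := twin_partitionP; split=> // I J piI piJ.
apply/(single_orbit_blockP hG); try exact: partition_block_neq0 p _.
move=> i i' j j' Ii Ii' Jj Jj'.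
have [tij _] := twins_block piI Ii Ii' j.
have [_ tji] := twins_block piJ Jj Jj' i'.
exact: unit_orbit_trans tij tji.
Qed.

Lemma twin_partition_coarsest pi :
  block_orbit_partition G A pi -> coarser twin_partition pi.
Proof.
move=> [p H] I piI; have I0 := partition_block_neq0 p piI.
have /set0Pn[i Ii] := I0.
have [/eqP covT _ _] := and3P twin_partitionP.
exists (pblock twin_partition i); first by rewrite pblock_mem // covT inE.
apply/subsetP=> i' Ii'; apply/mem_pblock_twin => j.
have [/eqP covp _ _] := and3P p.
have jcov : j \in cover pi by rewrite covp inE.
have piJ := pblock_mem jcov; have Jj : j \in pblock pi j by rewrite mem_pblock.
have J0 := partition_block_neq0 p piJ.
have [HIJ _] := single_orbit_blockP hG A I0 J0.
have [HJI _] := single_orbit_blockP hG A J0 I0.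
by split; [apply: HIJ => //; apply: H | apply: HJI => //; apply: H].
Qed.

End Twins.

Theorem proposition2p4 (R : comPzRingType) (G : R -> Prop)
    (hG : unit_subgroup G) (N : nat) (hN : (0 < N)%N) (A : 'M[R]_N) :
  exists! pi : {set {set 'I_N}},
    minimal_partition (block_orbit_partition G A) pi.
Proof.
exists (twin_partition G A); split.
  split=> [|pi Hpi c]; first exact: twin_partition_admissible.
  apply: coarser_antisym c (twin_partition_coarsest hG Hpi); first exact: Hpi.1.
  exact: twin_partitionP.
move=> pi [Hpi min_pi]; apply: min_pi; first exact: twin_partition_admissible.
exact: twin_partition_coarsest.
Qed.
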